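(* Let $d \geqslant 1$ and $k \geqslant 2$ be integers, and let $X \subset [0,1]^d$ be a nonempty $k$-self-similar set. Let $X_0,\ldots,X_{n-1}$ be the distinct nonempty sets in the $k$-kernel of $X$, and let $A = \{A_{ij}\}_{i,j=0}^{n-1}$ be the matrix in which $A_{ij}$ is the number of $\frac{1}{k}$-scaled copies of $X_i$ contained in $X_j$. Then $$\dim_{\mathcal{H}}(X) = \log_k(\rho(A)),$$ where $\dim_{\mathcal{H}}(X)$ is the Hausdorff dimension of $X$ and $\rho(A)$ is the spectral radius of $A$.
   Context: **$k$-self-similar sets.** For a compact set $Y \subset [0,1]^{d}$, an integer $k \geqslant 2$, an integer $a \geqslant 0$ and $\mathbf{b} = (b_1,\ldots,b_d) \in \mathbb{Z}^d$ with $0 \leqslant b_i < k^a$ for each $i$, set $$\mathcal{K}_{a,\mathbf{b}}^{k}(Y) := \Big\{(k^{a}x_{1}-b_{1},\ldots,k^{a}x_{d}-b_{d}) \;:\; (x_{1},\ldots,x_{d}) \in Y \cap \prod_{i=1}^{d}\Big[\frac{b_{i}}{k^{a}},\frac{b_{i}+1}{k^{a}}\Big]\Big\} \subset [0,1]^d.$$ The $k$-kernel of a compact set $X \subset [0,1]^d$ is the collection $\mathcal{K}_X^k = \{\mathcal{K}_{a,\mathbf{b}}^{k}(X) : a \geqslant 0,\ 0 \leqslant b_i < k^a\}$. The compact set $X$ is called $k$-self-similar if $\mathcal{K}_X^k$ is finite. **The matrix $A$.** If $X_0,\ldots,X_{n-1}$ are the distinct nonempty elements of $\mathcal{K}_X^k$,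 each $X_j$ is the union of its intersections with the closed grid hyper-cubes $\prod_{l=1}^d [\frac{b_l}{k},\frac{b_l+1}{k}]$, and each nonempty such intersection is a $\frac1k$-scaled copy of some $X_i$. ''The number of $\frac1k$-scaled copies of $X_i$ contained in $X_j$'' means the number of such grid cubes for which the rescaled intersection is $X_i$: $$A_{ij} = \#\{\mathbf{b} \in \{0,\ldots,k-1\}^d : \mathcal{K}_{1,\mathbf{b}}^k(X_j) = X_i\}.$$ *)

(* Defs.v *)
From HB Require Import structures.
From mathcomp Require Import all_boot all_order all_algebra.
From mathcomp Require Import complex.
From mathcomp Require Import all_classical all_reals all_analysis.

Set Implicit Arguments.
Unset Strict Implicit.
Unset Printing Implicit Defensive.

Import Order.TTheory GRing.Theory Num.Theory.
Import numFieldNormedType.Exports.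

Local Open Scope classical_set_scope.
Local Open Scope ring_scope.

(* The norm of 'rV[R]_d in the library is the maximum norm, hence the explicit
   Euclidean distance. The two induce the same topology. *)
Definition euclidean_dist {R : realType} {d : nat} (x y : 'rV[R]_d) : R :=
  Num.sqrt (\sum_(i < d) (x ord0 i - y ord0 i) ^+ 2).

(* This is -oo on the empty set. *)
Definition diam {R : realType} {d : nat} (U : set 'rV[R]_d) : \bar R :=
  ereal_sup [set z | exists x y, [/\ U x, U y & z = (euclidean_dist x y)%:E]].

(* The case distinction lets the empty set contribute 0 even when s = 0,
   whereas a nonempty set of diameter 0 contributes 0 `^ 0 = 1 when s = 0. *)
Definition diam_pow {R : realType} {d : nat} (s : R) (U : set 'rV[R]_d) :
    \bar R :=
  if `[< U = set0 >] then 0%E else (diam U `^ s)%E.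

Definition hausdorff_premeasure {R : realType} {d : nat} (s delta : R)
    (E : set 'rV[R]_d) : \bar R :=
  ereal_inf [set (\sum_(0 <= i <oo) diam_pow s (U i))%E | U in
    [set U : (set 'rV[R]_d)^nat |
      E `<=` \bigcup_i U i /\ forall i, (diam (U i) <= delta%:E)%E]].

Definition hausdorff_measure {R : realType} {d : nat} (s : R)
    (E : set 'rV[R]_d) : \bar R :=
  ereal_sup [set hausdorff_premeasure s delta E | delta in
    [set delta : R | 0 < delta]].

Definition hausdorff_dim {R : realType} {d : nat} (E : set 'rV[R]_d) : \bar R :=
  ereal_inf [set s%:E | s in
    [set s : R | 0 <= s /\ hausdorff_measure s E = 0%E]].

Definition unit_cube {R : realType} {d : nat} : set 'rV[R]_d :=
  [set x | forall i, 0 <= x ord0 i <= 1].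

Definition grid_cube {R : realType} {d : nat} (k a : nat) (b : 'I_d -> nat) :
    set 'rV[R]_d :=
  [set x | forall i,
    (b i)%:R / k%:R ^+ a <= x ord0 i <= ((b i)%:R + 1) / k%:R ^+ a].

Definition rescaled_piece {R : realType} {d : nat} (k a : nat)
    (b : 'I_d -> nat) (Y : set 'rV[R]_d) : set 'rV[R]_d :=
  [set \row_(i < d) (k%:R ^+ a * x ord0 i - (b i)%:R) | x in
    Y `&` grid_cube k a b].

Definition k_kernel {R : realType} {d : nat} (k : nat) (X : set 'rV[R]_d) :
    set (set 'rV[R]_d) :=
  [set Y | exists (a : nat) (b : 'I_d -> nat),
    (forall i, (b i < k ^ a)%N) /\ Y = rescaled_piece k a b X].

Definition self_similar {R : realType} {d : nat} (k : nat)
    (X : set 'rV[R]_d) : Prop :=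
  [/\ compact X, X `<=` unit_cube & finite_set (k_kernel k X)].

Definition copies_matrix {R : realType} {d n : nat} (k : nat)
    (Xs : 'I_n -> set 'rV[R]_d) : 'M[R]_n :=
  \matrix_(i < n, j < n)
    #|[pred b : {ffun 'I_d -> 'I_k} |
        `[< rescaled_piece k 1 (fun l => b l) (Xs j) = Xs i >]]|%:R.

(* The eigenvalues are the complex ones. The set is finite, and nonempty for
   0 < n, so that sup is then a maximum. *)
Definition spectral_radius {R : realType} {n : nat} (A : 'M[R]_n) : R :=
  sup [set ComplexField.Normc.normc l | l in
    [set l : R[i] | eigenvalue (map_mx (real_complex R) A) l]].

(* Main.v *)
Require Import Defs.
From HB Require Import structures.
From mathcomp Require Import all_boot all_order all_algebra.
From mathcomp Require Import complex.
From mathcomp Require Import all_classical all_reals all_analysis.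
From mathcomp Require Import ring lra zify.

Import Order.TTheory GRing.Theory Num.Theory.
Import numFieldNormedType.Exports.

Local Open Scope classical_set_scope.
Local Open Scope ring_scope.

(* Subdividing a times, X_j meets as many level-a grid cubes, counted with the
   words of base-k digits, as the j-th column sum of A^a. By Cayley-Hamilton
   these sums are O(t^a) for each t > rho(A), and covering X with level-a cubes
   gives the upper bound.

   For the lower bound, let x A = l x be a left eigenvector. By the triangle
   inequality v = |x| satisfies |l| v <= v A. Hence, if each cube of level a
   gets the weight |l|^-a, every finite family of cubes covering X_j has total
   weight at least v_j / max v. A ball of radius k^-a meets at most 3^d cubes of
   level a, so that H^s(X) > 0 as soon as 1 < |l| and k^s <= |l|. *)

(** * Geometric bounds for matrix powers applied to vectors killed by linear factors *)

Lemma recurrence_growth (F : numFieldType) (u w : nat -> F) (z t c : F) :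
  `|z| < t -> 0 <= c -> (forall a, u a.+1 = z * u a + w a) ->
  (forall a, `|w a| <= c * t ^+ a) ->
  forall a, `|u a| <= (`|u 0%N| + c / (t - `|z|)) * t ^+ a.
Proof.
move=> zt c0 uS wb; have t0 : 0 < t by exact: le_lt_trans zt.
have tz : 0 < t - `|z| by rewrite subr_gt0.
(* [K] is chosen so that |z| K + c <= K t, which is the induction step. *)
set K := _ + c / _; have K0 : 0 <= K by rewrite addr_ge0// divr_ge0// ltW.
elim=> [|a IH]; first by rewrite expr0 mulr1 lerDl divr_ge0// ltW.
rewrite uS (le_trans (ler_normD _ _))// normrM exprS.
apply: (@le_trans _ _ (`|z| * (K * t ^+ a) + c * t ^+ a)).
  by rewrite lerD// ler_wpM2l.
rewrite mulrA -mulrDl [leRHS]mulrA ler_wpM2r// ?exprn_ge0 ?(ltW t0)//.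
rewrite -lerBrDl [`|z| * _]mulrC -mulrBr mulrDl divfK ?gt_eqF// lerDr.
by rewrite mulr_ge0// ltW.
Qed.

(** Induction on the factors: the sequence of [B] obeys a recurrence of ratio [z], perturbed by the
    sequence of [(A - z%:M) *m B], which one factor fewer annihilates. Repeated roots are harmless
    since each modulus is strictly below [t]. *)
Lemma annihilated_growth (F : numFieldType) (n : nat) (A : 'M[F]_n.+1)
    (r : 'rV_n.+1) (t : F) (s : seq F) :
  0 < t -> (forall z, z \in s -> `|z| < t) ->
  forall B : 'cV_n.+1, (\prod_(z <- s) (A - z%:M)) *m B = 0 ->
  exists2 c, 0 <= c &
    forall a, `|(r *m A ^+ a *m B) ord0 ord0| <= c * t ^+ a.
Proof.
move=> t0; elim: s => [_ B|z s IH sz B].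
  rewrite big_nil => B0; exists 0 => // a.
  have -> : B = 0 by rewrite -B0 mul1mx.
  by rewrite mulmx0 mxE normr0 mul0r.
(* The head factor has to act on [B] first, so it must commute past the others. *)
have comA : GRing.comm (\prod_(y <- s) (A - y%:M)) (A - z%:M).
  have scC y (M : 'M[F]_n.+1) : GRing.comm M y%:M by exact: comm_mx_scalar.
  apply/commr_sym/commr_prod => y _; apply: commrB; last exact: scC.
  by apply/commr_sym/commrB.
rewrite big_cons -comA -mulmxA => /IH[y ys|c c0 wb].
  by apply: sz; rewrite inE ys orbT.
have zt : `|z| < t by apply: sz; rewrite mem_head.
pose u a := (r *m A ^+ a *m B) ord0 ord0.
have uS a : u a.+1 = z * u a + (r *m A ^+ a *m ((A - z%:M) *m B)) ord0 ord0.
  rewrite /u mulmxBl mulmxBr mul_scalar_mx -scalemxAr exprSr.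
  rewrite [A ^+ a * A]/(A ^+ a *m A) !mulmxA.
  rewrite [X in _ + X]mxE [X in _ + (_ + X)]mxE [X in _ + (_ - X)]mxE.
  by rewrite addrC subrK.
exists (`|u 0%N| + c / (t - `|z|)); last exact: recurrence_growth uS wb.
by rewrite addr_ge0// divr_ge0// subr_ge0 ltW.
Qed.

(** * Complex eigenvalues of real matrices *)

Section spectral_radius.
Context {R : realType}.

Lemma normr_normc (x : R[i]) : `|x| = (Normc.normc x)%:C%C.
Proof. by rewrite normc_def; case: x. Qed.

Lemma normc_ge0 (x : R[i]) : 0 <= Normc.normc x.
Proof. by case: x => a b; rewrite /= sqrtr_ge0. Qed.

Lemma spectral_radius_ge (n : nat) (A : 'M[R]_n) (l : R[i]) :
  eigenvalue (map_mx (real_complex R) A) l ->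
  Normc.normc l <= spectral_radius A.
Proof.
move=> lA; apply: ub_le_sup; last by exists l.
have [s ps] := closed_field_poly_normal
  (char_poly (map_mx (real_complex R) A)).
(* The sum of the moduli of all roots is the upper bound that [sup] requires. *)
exists (\sum_(z <- s) Normc.normc z) => _ [z zA <-].
move: (zA : eigenvalue _ z); rewrite eigenvalue_root_char ps.
rewrite (monicP (char_poly_monic _)) scale1r.
rewrite root_prod_XsubC => zs.
rewrite (perm_big _ (perm_to_rem zs)) big_cons lerDl.
by rewrite sumr_ge0// => y _; exact: normc_ge0.
Qed.

Lemma spectral_radius_le (n : nat) (A : 'M[R]_n.+1) (x : R) :
  (forall l, eigenvalue (map_mx (real_complex R) A) l -> Normc.normc l <= x) ->
  spectral_radius A <= x.
Proof.
move=> Ax; apply: ge_sup => [|_ [l lA <-]]; last exact: Ax.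
(* The set of moduli is nonempty: the characteristic polynomial is not constant, hence has a complex
   root. *)
have [] := closed_rootP (char_poly (map_mx (real_complex R) A)) _.
  by rewrite size_char_poly.
move=> l rl; exists (Normc.normc l), l => //=.
by rewrite eigenvalue_root_char.
Qed.

(** Over the complex numbers the characteristic polynomial splits, and by Cayley-Hamilton the
    product of its factors at [A] kills every [B]. *)
Lemma spectral_radius_growth (n : nat) (A : 'M[R]_n.+1) (t : R)
    (r : 'rV_n.+1) (B : 'cV_n.+1) :
  0 < t -> spectral_radius A < t ->
  exists2 c, 0 <= c &
    forall a, `|(r *m A ^+ a *m B) ord0 ord0| <= c * t ^+ a.
Proof.
move=> t0 At; pose f := real_complex R.
have [s ps] := closed_field_poly_normal (char_poly (map_mx f A)).
rewrite (monicP (char_poly_monic _)) scale1r in ps.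
have sP z : z \in s -> `|z| < f t.
  move=> zs; rewrite normr_normc ltcR (le_lt_trans _ At)//.
  apply: spectral_radius_ge.
  by rewrite eigenvalue_root_char ps root_prod_XsubC.
have ft0 : 0 < f t by rewrite ltcR.
have := Cayley_Hamilton (map_mx f A).
rewrite ps rmorph_prod/=.
under eq_bigr do rewrite rmorphB/= horner_mx_X horner_mx_C.
move=> A0.
have := @annihilated_growth _ _ (map_mx f A) (map_mx f r) _ _ ft0 sP
  (map_mx f B).
rewrite A0 mul0mx => /(_ erefl)[c c0 cP].
(* A nonnegative complex number is real, so its real part is the same constant. *)
exists (complex.Re c); first by move: c0; rewrite lecE => /andP[].
move=> a; have := cP a.
rewrite -rmorphXn/= -!map_mxM mxE -rmorphXn/= normr_normc.
rewrite -[c]RRe_real ?ger0_real//.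
rewrite -rmorphM/= lecR.
by rewrite expr0n addr0 sqrtr_sqr.
Qed.

(* [v] consists of the moduli of a complex left eigenvector. *)
Lemma real_subeigenvector (n : nat) (A : 'M[R]_n) (l : R[i]) :
  (forall i j, 0 <= A i j) -> eigenvalue (map_mx (real_complex R) A) l ->
  exists v : 'I_n -> R, [/\ forall j, 0 <= v j, exists j, 0 < v j &
    forall j, Normc.normc l * v j <= \sum_i v i * A i j].
Proof.
move=> A0 /eigenvalueP[x xA x0]; exists (fun j => Normc.normc (x ord0 j)).
split=> [j||j]; first exact: normc_ge0.
  have [j xj] : exists j, x ord0 j != 0.
    apply/existsP; apply: contraNT x0 => /existsPn xj0.
    by apply/eqP/rowP => j; rewrite mxE; apply/eqP/negPn/xj0.
  by exists j; rewrite -ltcR -normr_normc normr_gt0.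
rewrite -lecR rmorphM/= -!normr_normc -normrM.
have -> : l * x ord0 j = \sum_i x ord0 i * (A i j)%:C%C.
  move/rowP/(_ j): xA; rewrite !mxE => <-.
  by apply: eq_bigr => i _; rewrite mxE.
rewrite (le_trans (ler_norm_sum _ _ _))// rmorph_sum/=.
apply: ler_sum => i _; rewrite rmorphM normrM !normr_normc /=.
by rewrite expr0n addr0 sqrtr_sqr ger0_norm.
Qed.

End spectral_radius.

(** * Words, partial transitions and weights of prefix cuts *)

Section run.
Context {D I : finType} (t : I -> D -> option I).

(** A word is admissible from [j] when the result is not [None]. In the application [None] stands
    for an empty piece, and [Some i] gives the index of the piece that the word zooms into. *)
Fixpoint run (w : seq D) (j : I) : option I :=
  if w is c :: w' then obind (run w') (t j c) else Some j.

(* [L] is a prefix cut of the tree of admissible words issued from [j]. *)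
Lemma cut_weight (R : realFieldType) (v : I -> R) (V l : R) :
  (forall j, v j <= V) -> 0 <= V -> 0 < l ->
  (forall j, l * v j <= \sum_c oapp v 0 (t j c)) ->
  forall M j (L : seq (seq D)),
  (forall w, size w = M -> run w j -> has (fun e => prefix e w) L) ->
  v j <= V * \sum_(e <- L) l ^- size e.
Proof.
move=> vV V0 l0 lv.
have l_ge0 n : 0 <= l ^- n by rewrite invr_ge0 exprn_ge0// ltW.
(* The empty word alone contributes weight 1. *)
have nilL (j : I) (L : seq (seq D)) :
    [::] \in L -> v j <= V * \sum_(e <- L) l ^- size e.
  move=> nL; rewrite (perm_big _ (perm_to_rem nL)) big_cons/= invr1.
  apply: (le_trans (vV j)); rewrite ler_peMr// lerDl.
  by apply: sumr_ge0 => e _.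
elim=> [|M IH] j L LP.
  by apply: nilL; have /hasP[[|//] eL _] := LP [::] erefl erefl.
have [nL|nL] := boolP ([::] \in L); first exact: nilL.
(* The words of the cut that begin with [c], stripped of that letter, form a cut for the child along
   [c]; a missing child has weight 0. *)
pose starts c (e : seq D) := if e is x :: _ then x == c else false.
pose Lc c := [seq behead e | e <- L & starts c e].
have vc c : oapp v 0 (t j c) <= V * \sum_(e <- Lc c) l ^- size e.
  case tc: (t j c) => [i|]/=; last by rewrite mulr_ge0// sumr_ge0.
  apply: IH => w wM wi; have := LP (c :: w).
  rewrite /= wM tc => /(_ erefl wi)/hasP[[|x e] eL/=].
    by rewrite eL in nL.
  case/andP => /eqP xc ew; apply/hasP; exists e => //.
  by apply/mapP; exists (x :: e) => //; rewrite mem_filter/= xc eqxx -xc.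
(* The factor [l] pays for the stripped letter, and each word of [L] is counted for exactly one
   [c]. *)
rewrite -(ler_pM2l l0) (le_trans (lv j))//.
rewrite (le_trans (ler_sum _ (fun c _ => vc c)))// -mulr_sumr mulrCA.
rewrite ler_wpM2l// mulr_sumr.
under eq_bigr do rewrite big_map big_filter big_mkcond.
rewrite exchange_big/= le_eqVlt; apply/orP; left; apply/eqP.
rewrite [LHS]big_seq [RHS]big_seq; apply: eq_bigr => -[|x e] eL/=.
  by rewrite eL in nL.
rewrite -big_mkcond/= (big_pred1 x) => [|c]; last by rewrite /= eq_sym.
by rewrite exprS invfM mulrA divff ?gt_eqF// mul1r.
Qed.
End run.

(** * Zooming into grid cubes *)

Section pieces.
Context {R : realType} {d k : nat}.
Implicit Types (x y p : 'rV[R]_d) (b : 'I_d -> nat) (X Y : set 'rV[R]_d).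

(** The inverse of the rescaling map of [rescaled_piece]; with it a piece becomes a preimage cut
    down to the unit cube. *)
Definition unzoom (a : nat) b y : 'rV[R]_d :=
  \row_l ((y ord0 l + (b l)%:R) / k%:R ^+ a).

Context (k_gt1 : (1 < k)%N).

Let kX_gt0 a : 0 < k%:R ^+ a :> R.
Proof. by rewrite exprn_gt0// ltr0n ltnW. Qed.

Lemma rescaled_pieceE a b Y :
  rescaled_piece k a b Y = [set y | unit_cube y /\ Y (unzoom a b y)].
Proof.
apply/seteqP; split=> [_ [x [Yx xb] <-]|y [y01 Yy]] /=.
  split=> [l|].
    have := xb l; rewrite !mxE ler_pdivrMr// ler_pdivlMr// mulrC.
    move=> /andP[h1 h2].
    by apply/andP; split; lra.
  have -> // : unzoom a b (\row_i (k%:R ^+ a * x ord0 i - (b i)%:R)) = x.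
  by apply/rowP => l; rewrite !mxE subrK mulrC mulKf// gt_eqF.
exists (unzoom a b y); first (split=> // l).
  have := y01 l; rewrite !mxE ler_pM2r ?invr_gt0// ler_pM2r ?invr_gt0//.
  by move=> /andP[h1 h2]; apply/andP; split; lra.
by apply/rowP => l; rewrite !mxE mulrC divfK ?gt_eqF// addrK.
Qed.

Lemma unzoom0 y : unzoom 0 (fun=> 0%N) y = y.
Proof. by apply/rowP => l; rewrite mxE addr0 expr0 divr1. Qed.

(** Subdividing twice concatenates base-[k] expansions, with [a] leading and [a'] trailing
    digits. *)
Lemma unzoomD a a' b b' y : unzoom a b (unzoom a' b' y) =
  unzoom (a + a') (fun l => b l * k ^ a' + b' l)%N y.
Proof.
apply/rowP => l; rewrite !mxE natrD natrM natrX exprD.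
by field; rewrite ?gt_eqF.
Qed.

Lemma unzoom_unit_cube a b y : (forall l, (b l < k ^ a)%N) ->
  unit_cube y -> unit_cube (unzoom a b y).
Proof.
move=> ba y01 l; rewrite mxE ler_pdivrMr// mul1r divr_ge0 ?(ltW (kX_gt0 a))//=.
  have : (b l)%:R + 1 <= k%:R ^+ a :> R by rewrite natr1 -natrX ler_nat.
  by have /andP[h1 h2] := y01 l => h3; lra.
by have /andP[y0 _] := y01 l; rewrite addr_ge0.
Qed.

Lemma unit_cube_digit x : unit_cube x ->
  exists (c : {ffun 'I_d -> 'I_k}) y,
    unit_cube y /\ x = unzoom 1 (fun l => c l) y.
Proof.
move=> x01.
have cP l : exists c : 'I_k, c%:R <= k%:R * x ord0 l <= c%:R + 1.
  have /andP[x0 x1] := x01 l.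
  have kx0 : 0 <= k%:R * x ord0 l by rewrite mulr_ge0.
  have /andP[t1 t2] := truncn_itv kx0.
  have [tk|kt] := ltnP (Num.truncn (k%:R * x ord0 l)) k.
    by exists (Ordinal tk) => /=; rewrite t1 natr1 ltW.
  (* Only the coordinate 1 leads here: its truncation is [k], so the last digit [k.-1] is taken. *)
  have kk : (k.-1 < k)%N by rewrite prednK// ltnW.
  exists (Ordinal kk) => /=; rewrite natr1 prednK ?(ltnW k_gt1)//.
  rewrite ler_piMr// andbT (le_trans _ t1)// ler_nat (leq_trans _ kt)//.
  exact: leq_pred.
have [c {}cP] := choice cP.
exists [ffun l => c l], (\row_l (k%:R * x ord0 l - (c l)%:R)); split.
  by move=> l; rewrite mxE; have /andP[h1 h2] := cP l; lra.
apply/rowP => l; rewrite !mxE ffunE subrK mulrC mulKf//.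
by have := kX_gt0 1; rewrite expr1 => /gt_eqF ->.
Qed.

Lemma k_kernel_piece X Y (c : {ffun 'I_d -> 'I_k}) :
  k_kernel k X Y -> k_kernel k X (rescaled_piece k 1 (fun l => c l) Y).
Proof.
move=> [a [b [ba ->]]]; exists (a + 1)%N, (fun l => b l * k ^ 1 + c l)%N; split.
  move=> l; rewrite expnD expn1 (@leq_trans ((b l).+1 * k))//.
    by rewrite mulSn addnC ltn_add2r.
  by rewrite leq_mul2r ba orbT.
rewrite !rescaled_pieceE; apply/seteqP; split=> y /= [y01].
  by rewrite unzoomD => -[].
(* A piece of a piece also asks the intermediate point to lie in the unit cube, which holds because
   [c] is a valid index at level 1. *)
move=> Xy; split=> //; split; last by rewrite unzoomD.
by apply: unzoom_unit_cube => // l; rewrite expn1.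
Qed.

Lemma k_kernel_self X : X `<=` unit_cube -> k_kernel k X X.
Proof.
move=> X01; exists 0%N, (fun=> 0%N); split=> [l|]; first by rewrite expn0.
rewrite rescaled_pieceE; apply/seteqP; split=> y; rewrite /= unzoom0.
  by move=> Xy; split=> //; exact: X01.
by case.
Qed.

Lemma k_kernel_unit_cube X Y : k_kernel k X Y -> Y `<=` unit_cube.
Proof. by move=> [a [b [_ ->]]]; rewrite rescaled_pieceE => y []. Qed.

End pieces.

(** * The kernel as an automaton reading grid digits *)

Section transitions.
Context {R : realType} {d k n : nat} (k_gt1 : (1 < k)%N).
Context (Xs : 'I_n -> set 'rV[R]_d) (Xs_inj : injective Xs).
Context (Xs_cube : forall j, Xs j `<=` unit_cube).
Context (Xs_neq0 : forall j, Xs j !=set0).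

Let digit := {ffun 'I_d -> 'I_k}.
Implicit Types (c : digit) (w e : seq digit).

Let K c := rescaled_piece k 1 (fun l => c l) : set 'rV[R]_d -> set 'rV[R]_d.

Context (Xs_closed : forall j c,
  K c (Xs j) !=set0 -> exists i, K c (Xs j) = Xs i).

(** The choice is unambiguous by [Xs_inj]; the result is [None] exactly for an empty piece, by
    [Xs_closed] and [Xs_neq0]. *)
Definition child j c : option 'I_n := [pick i | `[< K c (Xs j) = Xs i >]].

Let zoom1 c : 'rV[R]_d -> 'rV[R]_d := unzoom (k := k) 1 (fun l => c l).

Lemma childP j c y : unit_cube y -> Xs j (zoom1 c y) ->
  exists2 i, child j c = Some i & Xs i y.
Proof.
move=> y01 Xy; have Ky : K c (Xs j) y by rewrite /K rescaled_pieceE.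
rewrite /child; case: pickP => [i /asboolP Ki|none].
  by exists i; rewrite -?Ki.
have [i Ki] := @Xs_closed j c (ex_intro _ _ Ky).
by have := none i; rewrite asboolT.
Qed.

Lemma child_sub j c i y : child j c = Some i -> Xs i y -> Xs j (zoom1 c y).
Proof.
rewrite /child; case: pickP => // i' /asboolP + [<-] Xy.
by move: Xy => /[swap] <-; rewrite /K rescaled_pieceE//= => -[].
Qed.

(** Links the automaton to the matrix: by injectivity each digit is counted in at most one entry of
    column [j]. *)
Lemma sum_child (f : 'I_n -> R) j :
  \sum_c oapp f 0 (child j c) = \sum_i f i * copies_matrix k Xs i j.
Proof.
transitivity (\sum_c \sum_i (`[< K c (Xs j) = Xs i >]%:R * f i)).
  apply: eq_bigr => c _; rewrite /child; case: pickP => [i Ki|none]/=.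
    rewrite (bigD1 i)//= Ki mul1r big1 ?addr0// => i' i'i.
    case: asboolP; rewrite ?mul0r// -/(K c) => Ki'.
    by move/asboolP: Ki i'i; rewrite Ki' => /Xs_inj ->; rewrite eqxx.
  by rewrite big1// => i _; rewrite none mul0r.
rewrite exchange_big; apply: eq_bigr => i _; rewrite mxE -mulr_suml mulrC.
rewrite -sum1_card natr_sum [in RHS]big_mkcond/=; congr (_ * _).
by apply: eq_bigr => c _; rewrite inE; case: asboolP.
Qed.

Fixpoint place w y : 'rV[R]_d :=
  if w is c :: w' then zoom1 c (place w' y) else y.

(** In each coordinate, the number whose base-[k] digits are the letters, the first being the most
    significant. *)
Fixpoint position w : 'I_d -> nat :=
  if w is c :: w' then fun l => (c l * k ^ size w' + position w' l)%N
  else fun=> 0%N.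

Lemma position_lt w l : (position w l < k ^ size w)%N.
Proof.
elim: w => //= c w IH; rewrite expnS.
rewrite (@leq_trans ((c l).+1 * k ^ size w))//.
  by rewrite mulSn addnC ltn_add2r.
by rewrite leq_mul2r ltn_ord orbT.
Qed.

(** Uniqueness of base-[k] expansions: quotient and remainder by [k ^ size e] recover the first
    letter and the rest. *)
Lemma position_inj w e : size w = size e -> position w =1 position e -> w = e.
Proof.
elim: w e => [|c w IH] [|c' e]//= [we] pe.
have k0 : (0 < k ^ size e)%N by rewrite expn_gt0 ltnW.
suff [cc pp] : c = c' /\ position w =1 position e by rewrite cc (IH e).
split=> [|l]; [apply/ffunP => l; apply: val_inj|]; have := pe l; rewrite we.
  move=> /(congr1 (divn^~ (k ^ size e)%N)); rewrite !divnMDl//.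
  by rewrite !divn_small ?addn0// -?we ?position_lt// we position_lt.
move=> /(congr1 (modn^~ (k ^ size e)%N)); rewrite !modnMDl.
by rewrite !modn_small// -?we ?position_lt// we position_lt.
Qed.

Lemma placeE w y : place w y = unzoom (k := k) (size w) (position w) y.
Proof.
elim: w => [|c w IH]; first by rewrite /= unzoom0.
by rewrite /= IH /zoom1 unzoomD.
Qed.

Lemma place_unit_cube w y : unit_cube y -> unit_cube (place w y).
Proof.
by rewrite placeE; apply: unzoom_unit_cube => //; exact: position_lt.
Qed.

Lemma place_cat w e y : place (w ++ e) y = place w (place e y).
Proof. by elim: w => //= c w ->. Qed.

Lemma run_sub w j i y : run child w j = Some i -> Xs i y -> Xs j (place w y).
Proof.
elim: w j => [|c w IH] j /=; first by move=> [->].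
by case jc: (child j c) => [i'|]//= wi Xy; apply: child_sub jc _; exact: IH.
Qed.

(** The whole closed cube of the word is tested, not only its part in one of the sets. *)
Definition meets_ball (p : 'rV[R]_d) (a : nat) (w : seq digit) :=
  exists y, unit_cube y /\ ball p (k%:R ^- a) (place w y).

(** Balls are those of the maximum norm, so the coordinates separate. With z the coordinate of the
    centre times k^a, the index of a cube that meets the ball lies in the open interval from z - 2
    to z + 1, which contains at most three integers. *)
Lemma card_meets_ball (p : 'rV[R]_d) a :
  (#|[pred w : a.-tuple digit | `[< meets_ball p a w >]]| <= 3 ^ d)%N.
Proof.
have kX0 : 0 < k%:R ^+ a :> R by rewrite exprn_gt0// ltr0n ltnW.
(* The largest possible index in coordinate [l]. The argument of [Num.truncn] is nonnegative as soon
   as some cube meets the ball, so the truncation is then a true floor. *)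
pose m l := Num.truncn (k%:R ^+ a * p ord0 l + 1 : R).
pose f (w : a.-tuple digit) : {ffun 'I_d -> 'I_3} :=
  [ffun l => inord (position w l + 2 - m l)].
have -> : (3 ^ d)%N = #|{ffun 'I_d -> 'I_3}| by rewrite card_ffun !card_ord.
have mP (w : a.-tuple digit) l : meets_ball p a w ->
    (m l <= position w l + 2 <= m l + 2)%N.
  move=> [y [y01 [_ /(_ ord0 l)]]].
  rewrite placeE mxE size_tuple /ball/= => pb.
  have {}pb : `|k%:R ^+ a * p ord0 l - (y ord0 l + (position w l)%:R)| < 1.
    rewrite -(ltr_pM2l kX0) in pb; rewrite mulfV ?gt_eqF// in pb.
    rewrite -{1}(gtr0_norm kX0) -normrM mulrBr mulrC mulrCA in pb.
    by rewrite mulfV ?gt_eqF// mulr1 mulrC in pb.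
  move: pb; rewrite ltr_distl => /andP[z1 z2].
  have /andP[y0 y1] := y01 l.
  have pos0 : 0 <= (position w l)%:R :> R by [].
  have z0 : 0 <= k%:R ^+ a * p ord0 l + 1 by lra.
  have /andP[m1 m2] := truncn_itv z0.
  rewrite -/(m l) in m1 m2.
  have h1 : (m l < position w l + 3)%N by rewrite -(ltr_nat R) natrD; lra.
  have h2 : (position w l < (m l).+1)%N by rewrite -(ltr_nat R) -natr1; lra.
  by lia.
rewrite -(card_in_imset (f := f)
  (D := [pred w : a.-tuple digit | `[< meets_ball p a w >]])).
  exact: max_card.
move=> w e; rewrite !inE => wP eP fwe.
apply: val_inj; apply: position_inj; first by rewrite !size_tuple.
move=> l; have /andP[w1 w2] := mP w l wP; have /andP[e1 e2] := mP e l eP.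
have := congr1 (fun g : {ffun _ -> _} => val (g l)) fwe.
rewrite /= !ffunE.
move: (position w l) (position e l) (m l) w1 w2 e1 e2 => u v q.
move=> w1 w2 e1 e2; rewrite !inordK; lia.
Qed.

(** Each ball is replaced by the at most 3^d words of its level whose cubes it meets; together these
    words form a cut. *)
Lemma ball_cover_weight (v : 'I_n -> R) (V l : R) (j : 'I_n)
    (S : seq ('rV[R]_d * nat)) :
  (forall i, v i <= V) -> 0 <= V -> 0 < l ->
  (forall i, l * v i <= \sum_i' v i' * copies_matrix k Xs i' i) ->
  Xs j `<=` [set x | exists2 q, q \in S & ball q.1 (k%:R ^- q.2) x] ->
  v j <= V * (3 ^ d)%:R * \sum_(q <- S) l ^- q.2.
Proof.
move=> vV V0 l0 lv XS.
pose near (q : 'rV[R]_d * nat) : seq (seq digit) :=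
  [seq val w | w : q.2.-tuple digit <-
    enum [pred w : q.2.-tuple digit | `[< meets_ball q.1 q.2 w >]]].
pose L := flatten [seq near q | q <- S].
(* At the maximal level, an admissible word ends in a nonempty set. A point of it lies in some ball
   [q], which the cube of the prefix of length [q.2] therefore meets. *)
have L_cut w : size w = \max_(q <- S) q.2 -> run child w j ->
    has (fun e => prefix e w) L.
  move=> wM; case wi: (run child w j) => [i|//] _.
  have [y Xy] := Xs_neq0 i.
  have [q qS qy] := XS _ (run_sub _ _ _ _ wi Xy).
  have qw : (q.2 <= size w)%N by rewrite wM; exact: leq_bigmax_seq.
  have tw : size (take q.2 w) == q.2 by rewrite size_takel.
  apply/hasP; exists (take q.2 w); last exact: prefix_take.
  apply/flattenP; exists (near q); first exact: map_f.
  apply/mapP; exists (Tuple tw) => //.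
  rewrite mem_enum inE; exists (place (drop q.2 w) y).
  split; first exact: (place_unit_cube _ _ (Xs_cube i y Xy)).
  by rewrite -place_cat cat_take_drop.
apply: (le_trans (cut_weight _ _ _ _ _ vV V0 l0 _ _ _ _ L_cut)).
  by move=> i; rewrite sum_child.
rewrite -mulrA ler_wpM2l// big_flatten big_map mulr_sumr.
apply: ler_sum => q _; rewrite big_map big_enum/=.
under eq_bigr do rewrite size_tuple.
rewrite sumr_const -[leLHS]mulr_natl ler_wpM2r ?invr_ge0 ?exprn_ge0 ?(ltW l0)//.
by rewrite ler_nat card_meets_ball.
Qed.

Definition box (p : 'rV[R]_d) (r : R) : set 'rV[R]_d :=
  [set x | forall l, p ord0 l <= x ord0 l <= p ord0 l + r].

(* [N a j] is the [j]-th column sum of the [a]-th power of the matrix. *)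
Lemma box_cover (N : nat -> 'I_n -> R) :
  (forall j, N 0%N j = 1) ->
  (forall a j, N a.+1 j = \sum_i N a i * copies_matrix k Xs i j) ->
  forall a j, exists2 L : seq 'rV[R]_d, (size L)%:R = N a j &
    Xs j `<=` [set x | exists2 p, p \in L & box p (k%:R ^- a) x].
Proof.
move=> N0 NS; elim=> [|a IH] j.
  exists [:: 0]; first by rewrite N0.
  move=> x Xx; exists 0; first by rewrite mem_head.
  by move=> l; rewrite mxE add0r expr0 invr1; exact: (Xs_cube _ _ Xx l).
have [L sL LP] : exists2 L : 'I_n -> seq 'rV[R]_d,
    (forall i, (size (L i))%:R = N a i) &
    (forall i, Xs i `<=` [set x | exists2 p, p \in L i & box p (k%:R ^- a) x]).
  have /choice[L LP] : forall i, exists L : seq 'rV[R]_d, (size L)%:R = N a i /\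
    Xs i `<=` [set x | exists2 p, p \in L & box p (k%:R ^- a) x].
    by move=> i; have [L ? ?] := IH i; exists L.
  by exists L => i; have [] := LP i.
(* The corners of the child's boxes, shrunk into the cube of the digit [c]; an empty piece needs no
   box. *)
pose Lc c := oapp (fun i => [seq zoom1 c p | p <- L i]) [::] (child j c).
exists (flatten [seq Lc c | c : digit]).
  rewrite size_flatten /shape -map_comp sumnE big_map natr_sum big_enum/=.
  rewrite NS -sum_child; apply: eq_bigr => c _; rewrite /Lc.
  by case: (child j c) => [i|]//=; rewrite size_map sL.
move=> x Xx; have [c [y [y01 xy]]] := unit_cube_digit k_gt1 _ (Xs_cube _ _ Xx).
rewrite xy in Xx; have [i ji Xy] := childP _ _ _ y01 Xx.
have [p pL py] := LP _ _ Xy.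
exists (zoom1 c p).
  apply/flattenP; exists (Lc c); first by apply: map_f; rewrite mem_enum.
  by rewrite /Lc ji /=; exact: map_f.
have k0 : 0 < k%:R^-1 :> R by rewrite invr_gt0 ltr0n ltnW.
move=> l; rewrite xy !mxE expr1 exprSr invfM -mulrDl !ler_pM2r//.
by have /andP[h1 h2] := py l; apply/andP; split; lra.
Qed.

End transitions.

(** * Vanishing and positivity of the Hausdorff measure *)

Section hausdorff.
Context {R : realType} {d : nat}.
Implicit Types (x y p : 'rV[R]_d) (U E : set 'rV[R]_d) (s r : R).

Lemma near_geometric_lt (c z e : R) : 0 <= z -> z < 1 -> 0 < e ->
  \forall a \near \oo, c * z ^+ a < e.
Proof.
move=> z0 z1 e0; have z1' : `|z| < 1 by rewrite ger0_norm.
exact: (cvgr_lt _ (cvg_geometric c z1')).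
Qed.

Lemma powR_exprV (x s : R) (a : nat) : 0 <= x -> (x ^- a) `^ s = (x `^ s) ^- a.
Proof.
move=> x0; have E (y : R) : 0 <= y -> y ^- a = y `^ (- a%:R).
  by move=> y0; rewrite powRN powR_mulrn.
by rewrite (E _ x0) (E _ (powR_ge0 x s)) -[LHS]powRrM -[RHS]powRrM mulrC.
Qed.

Lemma dist_coord_le x y l : `|x ord0 l - y ord0 l| <= euclidean_dist x y.
Proof.
rewrite -sqrtr_sqr ler_sqrt ?sumr_ge0// => [|i _]; last exact: sqr_ge0.
by rewrite (bigD1 l)//= lerDl sumr_ge0// => i _; exact: sqr_ge0.
Qed.

Lemma diam_ge_dist U x y : U x -> U y -> ((euclidean_dist x y)%:E <= diam U)%E.
Proof. by move=> Ux Uy; apply: ereal_sup_ubound; exists x, y. Qed.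

Lemma diam_ge0 U x : U x -> (0 <= diam U)%E.
Proof.
move=> Ux; apply: le_trans (diam_ge_dist _ _ _ Ux Ux).
by rewrite lee_fin sqrtr_ge0.
Qed.

Lemma diam_pow_ge0 s U : (0 <= diam_pow s U)%E.
Proof. by rewrite /diam_pow; case: asboolP => _ //; exact: poweR_ge0. Qed.

(** The factor [Num.sqrt d%:R] is the Euclidean diameter of the unit cube. *)
Lemma diam_box p r : 0 <= r -> (diam (box p r) <= (Num.sqrt d%:R * r)%:E)%E.
Proof.
move=> r0; apply: ge_ereal_sup => _ [x [y [px py ->]]].
rewrite lee_fin /euclidean_dist -[X in _ * X](ger0_norm r0) -sqrtr_sqr.
rewrite -sqrtrM//.
rewrite ler_sqrt ?mulr_ge0// ?sqr_ge0//.
rewrite [leRHS]mulr_natl -[d in leRHS]card_ord -sumr_const.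
apply: ler_sum => l _; rewrite -[leLHS]real_normK ?num_real//.
rewrite ler_sqr ?nnegrE// ler_norml.
have /andP[? ?] := px l; have /andP[? ?] := py l.
by apply/andP; split; lra.
Qed.

Lemma diam_pow_box s p r : 0 <= s -> 0 <= r ->
  (diam_pow s (box p r) <= ((Num.sqrt d%:R * r) `^ s)%:E)%E.
Proof.
move=> s0 r0; rewrite /diam_pow; case: asboolP => [_|/eqP/set0P[x px]].
  by rewrite lee_fin powR_ge0.
rewrite -poweR_EFin gt0_ler_poweR ?diam_box// in_itv/= leey andbT.
  exact: diam_ge0 px.
by rewrite lee_fin mulr_ge0// sqrtr_ge0.
Qed.

Lemma hausdorff_premeasure_ge0 s r E : (0 <= hausdorff_premeasure s r E)%E.
Proof.
apply: le_ereal_inf_tmp => _ [U _ <-].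
by apply: nneseries_ge0 => i _ _; exact: diam_pow_ge0.
Qed.

Lemma hausdorff_premeasure_boxes s (delta r : R) E (L : seq 'rV[R]_d) :
  0 <= s -> 0 <= r -> Num.sqrt d%:R * r <= delta ->
  E `<=` [set x | exists2 p, p \in L & box p r x] ->
  (hausdorff_premeasure s delta E <=
   ((size L)%:R * (Num.sqrt d%:R * r) `^ s)%:E)%E.
Proof.
move=> s0 r0 rdelta EL; pose U i := nth set0 [seq box p r | p <- L] i.
have UE i : (i < size L)%N -> exists p, U i = box p r.
  by move=> iL; exists (nth 0 L i); rewrite /U (nth_map 0).
have U0 i : (size L <= i)%N -> U i = set0.
  by move=> iL; rewrite /U nth_default// size_map.
apply: (@le_trans _ _ (\sum_(0 <= i <oo) diam_pow s (U i))%E).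
  apply: ereal_inf_lbound; exists U => //; split=> [x /EL[p pL px]|i].
    exists (index p L) => //; rewrite /U (nth_map 0) ?index_mem//.
    by rewrite nth_index.
  have [/UE[p ->]|/U0 ->] := ltnP i (size L).
    by apply: le_trans (diam_box p r r0) _; rewrite lee_fin.
  by apply: ge_ereal_sup => _ [? [? [[]]]].
rewrite (@nneseries_split _ _ 0 (size L)) => [|i _]; last exact: diam_pow_ge0.
rewrite eseries0 ?adde0; last first.
  by move=> i iL _; rewrite U0// /diam_pow asboolT.
rewrite add0n mulr_natl -{2}[size L]subn0 -sumr_const_nat -sumEFin.
rewrite big_nat [leRHS]big_nat; apply: lee_sum => i /= iL.
by have [p ->] := UE _ iL; exact: diam_pow_box.
Qed.

Lemma hausdorff_measure_boxes_eq0 (k : nat) s (c t : R) E :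
  (1 < k)%N -> 0 <= s -> 0 <= c -> 0 <= t -> t < k%:R `^ s ->
  (forall a, exists2 L : seq 'rV[R]_d, (size L)%:R <= c * t ^+ a &
    E `<=` [set x | exists2 p, p \in L & box p (k%:R ^- a) x]) ->
  hausdorff_measure s E = 0%E.
Proof.
move=> k1 s0 c0 t0 tk EL.
have ks0 : 0 < (k%:R : R) `^ s by rewrite powR_gt0// ltr0n ltnW.
have k0 : 0 < k%:R :> R by rewrite ltr0n ltnW.
suff pre0 delta : 0 < delta -> hausdorff_premeasure s delta E = 0%E.
  apply/eqP; rewrite eq_le; apply/andP; split.
    by apply: ge_ereal_sup => _ [delta /pre0 -> <-].
  by apply: ereal_sup_ubound; exists 1; [exact: ltr01|exact: pre0].
move=> delta0; apply/eqP; rewrite eq_le hausdorff_premeasure_ge0 andbT.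
apply/lee_addgt0Pr => e e0; rewrite add0e.
have [a [a1 a2]] : exists a, Num.sqrt d%:R * k%:R^-1 ^+ a < delta /\
    c * (Num.sqrt d%:R `^ s) * (t / k%:R `^ s) ^+ a < e.
  have H1 : \forall a \near \oo, Num.sqrt d%:R * k%:R^-1 ^+ a < delta.
    by apply: near_geometric_lt; rewrite ?invr_ge0// invf_lt1// ltr1n.
  have H2 : \forall a \near \oo,
      c * (Num.sqrt d%:R `^ s) * (t / k%:R `^ s) ^+ a < e.
    apply: near_geometric_lt; rewrite ?divr_ge0 ?powR_ge0//.
    by rewrite ltr_pdivrMr// mul1r.
  near \oo => a; exists a; split; near: a; [exact: H1|exact: H2].
have [L sL EL'] := EL a.
rewrite exprVn in a1.
have r0 : 0 <= k%:R ^- a :> R by rewrite invr_ge0 exprn_ge0.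
apply: le_trans (hausdorff_premeasure_boxes _ _ _ _ _ s0 r0 (ltW a1) EL') _.
rewrite lee_fin (le_trans _ (ltW a2))// powRM ?sqrtr_ge0// powR_exprV ?ler0n//.
rewrite expr_div_n [leRHS]mulrACA ler_wpM2r//.
Unshelve. all: by end_near.
Qed.

Lemma small_set_ball (k a0 : nat) s (l : R) U (e : R) :
  (1 < k)%N -> 0 <= s -> 1 < l -> k%:R `^ s <= l -> 0 < e ->
  (diam U < (k%:R ^- a0)%:E)%E ->
  exists q : 'rV[R]_d * nat, U `<=` ball q.1 (k%:R ^- (a0 + q.2)) /\
    ((l ^- q.2)%:E <= ((k%:R ^+ a0.+1) `^ s)%:E * diam_pow s U + e%:E)%E.
Proof.
move=> k1 s0 l1 kl e0 Ua0.
have k0 : 0 < k%:R :> R by rewrite ltr0n ltnW.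
have kX0 a : 0 < k%:R ^- a :> R by rewrite invr_gt0 exprn_gt0.
have l0 : 0 < l by exact: lt_trans l1.
have linv1 : l^-1 < 1 by rewrite invf_lt1.
have [a la] : exists a, l ^- a < e.
  have linv0 : 0 <= l^-1 by rewrite invr_ge0 ltW.
  have [a _ /(_ a (leqnn a))] := near_geometric_lt 1 _ _ linv0 linv1 e0.
  by rewrite /= mul1r exprVn => ae; exists a.
have large q : U `<=` ball q (k%:R ^- (a0 + a)) ->
    exists q : 'rV[R]_d * nat, U `<=` ball q.1 (k%:R ^- (a0 + q.2)) /\
    ((l ^- q.2)%:E <= ((k%:R ^+ a0.+1) `^ s)%:E * diam_pow s U + e%:E)%E.
  move=> Uq; exists (q, a); split=> //=; apply: (@le_trans _ _ e%:E).
    by rewrite lee_fin ltW.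
  by rewrite leeDr// mule_ge0 ?diam_pow_ge0// lee_fin powR_ge0.
have [U0|/set0P[p Up]] := eqVneq U set0.
  by apply: (large 0); rewrite U0 => x.
have UD : diam U = (fine (diam U))%:E.
  by rewrite fineK// ge0_fin_numE ?(diam_ge0 _ _ Up)// (lt_trans Ua0)// ltry.
set D := fine _ in UD.
have D_ge0 : 0 <= D by rewrite -lee_fin -UD (diam_ge0 _ _ Up).
have U_ball r : D < r -> U `<=` ball p r.
  move=> Dr x Ux; split=> [|i l']; first exact: le_lt_trans Dr.
  rewrite ord1; apply: le_lt_trans Dr; apply: (le_trans (dist_coord_le _ _ _)).
  by rewrite -lee_fin -UD diam_ge_dist.
have [D0|D0] := eqVneq D 0.
  by apply: (large p); apply: U_ball; rewrite D0.
have {D0}D_gt0 : 0 < D by rewrite lt_neqAle eq_sym D0.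
have kinv1 : k%:R^-1 < 1 :> R by rewrite invf_lt1// ltr1n.
have exD : exists a, k%:R ^- (a0 + a.+1) <= D.
  have kinv0 : 0 <= k%:R^-1 :> R by rewrite invr_ge0.
  have [b _ /(_ b (leqnn b))] := near_geometric_lt 1 _ _ kinv0 kinv1 D_gt0.
  rewrite /= mul1r => bD; exists b; rewrite -exprVn.
  have bb : (b <= a0 + b.+1)%N := leq_trans (leqnSn b) (leq_addl _ _).
  exact: (le_trans (ler_wiXn2l kinv0 (ltW kinv1) bb) (ltW bD)).
have [b bD bmin] := ex_minnP exD.
exists (p, b); split=> /=.
  apply: U_ball; case: b bmin {bD} => [_|b bmin].
    by rewrite addn0 -lte_fin -UD.
  by rewrite ltNge; apply/negP => /bmin; rewrite ltnn.
apply: (@le_trans _ _ (((k%:R ^+ a0.+1) `^ s)%:E * diam_pow s U)%E); last first.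
  by rewrite leeDl// lee_fin ltW.
rewrite /diam_pow asboolF => [|U0]; last by rewrite U0 in Up.
rewrite UD poweR_EFin -EFinM lee_fin.
apply: (@le_trans _ _ ((k%:R `^ s) ^- b)).
  rewrite lef_pV2 ?posrE ?exprn_gt0 ?powR_gt0//.
  by rewrite lerXn2r// nnegrE ?powR_ge0// ltW.
rewrite -powR_exprV ?ler0n//.
have -> : k%:R ^- b = k%:R ^+ a0.+1 * k%:R ^- (a0 + b.+1) :> R.
  by rewrite addnS -addSn exprD invfM mulVKf// gt_eqF// exprn_gt0.
rewrite powRM ?ler0n ?exprn_ge0 ?(ltW (kX0 _))// ler_wpM2l ?powR_ge0//.
by rewrite ge0_ler_powR// nnegrE ltW.
Qed.

Lemma hausdorff_measure_neq0 (k a0 : nat) (b0 : 'I_d -> nat) s (l kappa : R)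
    (X Y : set 'rV[R]_d) :
  (1 < k)%N -> 0 <= s -> 1 < l -> k%:R `^ s <= l -> 0 < kappa -> compact X ->
  Y = rescaled_piece k a0 b0 X ->
  (forall S : seq ('rV[R]_d * nat),
    Y `<=` [set x | exists2 q, q \in S & ball q.1 (k%:R ^- q.2) x] ->
    kappa <= \sum_(q <- S) l ^- q.2) ->
  hausdorff_measure s X != 0%E.
Proof.
move=> k1 s0 l1 kl kappa0 cX YX Ykappa; apply/eqP => HX.
have k0 : 0 < k%:R :> R by rewrite ltr0n ltnW.
have kX0 a : 0 < k%:R ^- a :> R by rewrite invr_gt0 exprn_gt0.
have l0 : 0 < l by exact: lt_trans l1.
pose C : R := (k%:R ^+ a0.+1) `^ s; have C0 : 0 <= C by exact: powR_ge0.
pose e := kappa / (2 * (C + 1)).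
have e0 : 0 < e by rewrite divr_gt0// mulr_gt0// ltr_wpDl.
pose delta : R := k%:R ^- a0 / 2.
have delta0 : 0 < delta by rewrite divr_gt0.
have : (hausdorff_premeasure s delta X < e%:E)%E.
  apply: (@le_lt_trans _ _ 0%E); last by rewrite lte_fin.
  by rewrite -HX; apply: ereal_sup_ubound; exists delta.
move=> /ereal_inf_lt[_ [U [XU Udelta] <-] Ue].
have /choice[q qP] i : exists q : 'rV[R]_d * nat,
    U i `<=` ball q.1 (k%:R ^- (a0 + q.2)) /\
    ((l ^- q.2)%:E <= C%:E * diam_pow s (U i) + (e / (2 ^ i.+1)%:R)%:E)%E.
  apply: small_set_ball => //; first by rewrite divr_gt0// ltr0n expn_gt0.
  apply: le_lt_trans (Udelta i) _; rewrite lte_fin ltr_pdivrMr//.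
  by rewrite ltr_pMr// ltr1n.
move: cX; rewrite compact_cover.
move=> /(_ nat setT (fun i => ball (q i).1 (k%:R ^- (a0 + (q i).2)))).
case=> [i _|x /XU[i _ Ux]|F _ XF]; first exact: ball_open.
  by exists i => //; exact: (qP i).1.
have [N FN] : exists N, forall i : nat, i \in finmap.enum_fset F -> (i < N)%N.
  exists (\max_(i <- finmap.enum_fset F) i).+1 => i Fi.
  by rewrite ltnS; apply: (leq_bigmax_seq (F := id)).
pose f i : 'rV[R]_d * nat :=
  (\row_m (k%:R ^+ a0 * (q i).1 ord0 m - (b0 m)%:R), (q i).2).
have := Ykappa [seq f i | i <- iota 0 N].
rewrite big_map => /(_ _)/wrap[].
  move=> y; rewrite YX rescaled_pieceE => // -[_ /XF[i Fi [_ /= yi]]].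
  exists (f i).
    by apply: map_f; rewrite mem_iota/= add0n; exact: FN.
  split=> [|i' m]; first exact: kX0.
  have := yi ord0 m; rewrite /ball/= !ord1 !mxE.
  have K0 : 0 < k%:R ^+ a0 :> R by rewrite exprn_gt0.
  rewrite exprD invfM ltr_pdivlMl// -{1}(gtr0_norm K0) -normrM.
  have -> // : k%:R ^+ a0 *
      ((q i).1 0 m - (y ord0 m + (b0 m)%:R) / k%:R ^+ a0) =
    k%:R ^+ a0 * (q i).1 0 m - (b0 m)%:R - y 0 m.
  rewrite mulrBr mulrC [X in _ - X]mulrCA mulfV ?gt_eqF// mulr1.
  by rewrite opprD addrA addrAC mulrC.
apply/negP; rewrite -ltNge -lte_fin.
apply: (@le_lt_trans _ _ (C%:E * e%:E + e%:E)%E); last first.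
  have C1 : C + 1 != 0 by rewrite gt_eqF// ltr_wpDl.
  rewrite lte_fin (_ : C * e + e = kappa / 2).
    by rewrite ltr_pdivrMr// ltr_pMr// ltr1n.
  by rewrite /e; field; rewrite C1.
apply: (@le_trans _ _ (\sum_(0 <= i <oo)
    (C%:E * diam_pow s (U i) + (e / (2 ^ i.+1)%:R)%:E))%E).
  rewrite -sumEFin -[N in iota 0 N]subn0 -/(index_iota 0 N).
  apply: le_trans (nneseries_lim_ge N _).
    by apply: lee_sum => i _; exact: (qP i).2.
  move=> i _ _; rewrite adde_ge0// ?mule_ge0 ?diam_pow_ge0//.
  by rewrite lee_fin divr_ge0// ltW.
apply: (le_trans (epsilon_trick _ _ _)).
- by move=> i; rewrite mule_ge0 ?diam_pow_ge0.
- exact: ltW.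
rewrite leeD2r// nneseriesZl => [|i _]; last exact: diam_pow_ge0.
by rewrite lee_wpmul2l// ltW.
Qed.

End hausdorff.

Theorem proposition1 (R : realType) (d k : nat) (hd : (1 <= d)%N)
    (hk : (2 <= k)%N) (X : set 'rV[R]_d) (X_neq0 : X !=set0)
    (X_ss : self_similar k X)
    (n : nat) (Xs : 'I_n -> set 'rV[R]_d) (Xs_inj : injective Xs)
    (Xs_range : range Xs = [set Y | k_kernel k X Y /\ Y !=set0]) :
  hausdorff_dim X =
    (ln (spectral_radius (copies_matrix k Xs)) / ln (k%:R))%:E.
Proof.
have [cX X01 _] := X_ss.
have kX j : k_kernel k X (Xs j) /\ Xs j !=set0.
  by have : range Xs (Xs j) by [exists j]; rewrite Xs_range.
have kXs Y : k_kernel k X Y -> Y !=set0 -> exists i, Y = Xs i.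
  move=> XY Y0; have : range Xs Y by rewrite Xs_range.
  by case=> i _ <-; exists i.
have Xs_cube j : Xs j `<=` unit_cube := k_kernel_unit_cube hk _ _ (kX j).1.
have Xs_neq0 j : Xs j !=set0 := (kX j).2.
have Xs_closed j (c : {ffun 'I_d -> 'I_k}) :
    rescaled_piece k 1 (fun l => c l) (Xs j) !=set0 ->
    exists i, rescaled_piece k 1 (fun l => c l) (Xs j) = Xs i.
  by apply: kXs; apply: k_kernel_piece => //; exact: (kX j).1.
have [jX XE] := kXs X (k_kernel_self hk _ X01) X_neq0.
case: n => [|n] in Xs Xs_inj Xs_range kX kXs Xs_cube Xs_neq0 Xs_closed jX XE *.
  by case: jX {XE}.
set A := copies_matrix k Xs; set rho := spectral_radius A.
pose N a j := ((const_mx 1 : 'rV[R]_n.+1) *m A ^+ a) ord0 j.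
have N_box := box_cover hk Xs Xs_inj Xs_cube Xs_closed N _ _.
have {}N_box a j : exists2 L : seq 'rV[R]_d, (size L)%:R = N a j &
    Xs j `<=` [set x | exists2 p, p \in L & box p (k%:R ^- a) x].
  apply: N_box => [i|b i]; first by rewrite /N mulmx1 mxE.
  by rewrite /N exprSr [A ^+ b * A]/(A ^+ b *m A) mulmxA mxE.
have N_ge1 a j : 1 <= N a j.
  have [L <- LX] := N_box a j; have [x /LX[p pL _]] := Xs_neq0 j.
  by case: L pL {LX} => //= q L _; rewrite ler1n.
have N_growth t : 0 < t -> rho < t ->
    exists2 c, 0 <= c & forall a, N a jX <= c * t ^+ a.
  move=> t0 rt; have [c c0 cP] :=
    spectral_radius_growth n A t (const_mx 1) (delta_mx jX ord0) t0 rt.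
  exists c => // a; apply: le_trans (cP a); rewrite -colE mxE; exact: ler_norm.
have k0 : 0 < k%:R :> R by rewrite ltr0n ltnW.
have lnk : 0 < ln (k%:R : R) by rewrite ln_gt0// ltr1n.
have rho_ge1 : 1 <= rho.
  rewrite leNgt; apply/negP => rho_lt1.
  pose t := (Num.max 0 rho + 1) / 2.
  have m1 : Num.max 0 rho < 1 by rewrite gt_max ltr01.
  have m0 : 0 <= Num.max 0 rho by rewrite le_max lexx.
  have mr : rho <= Num.max 0 rho by rewrite le_max lexx orbT.
  have t_gt0 : 0 < t by rewrite /t; lra.
  have rt : rho < t by rewrite /t; lra.
  have [c c0 cN] := N_growth t t_gt0 rt.
  have t1 : t < 1 by rewrite /t; lra.
  have [a _ /(_ a (leqnn a))/=] := near_geometric_lt c t 1 (ltW t_gt0) t1 ltr01.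
  by rewrite ltNge (le_trans (N_ge1 a jX) (cN a)).
have rho_gt0 : 0 < rho by exact: lt_le_trans rho_ge1.
have krho : k%:R `^ (ln rho / ln k%:R) = rho.
  by rewrite /powR gt_eqF// divfK ?gt_eqF// lnK.
apply/eqP; rewrite eq_le; apply/andP; split.
  apply/lee_addgt0Pr => e e0; rewrite -EFinD.
  set s := _ + e.
  have s0 : 0 <= s by rewrite addr_ge0 ?(ltW e0)// divr_ge0 ?(ltW lnk)// ln_ge0.
  have rs : rho < k%:R `^ s.
    rewrite /powR gt_eqF// -[ltLHS]lnK ?posrE// ltr_expR -ltr_pdivrMr//.
    by rewrite /s ltrDl.
  pose t := (rho + k%:R `^ s) / 2.
  have t0 : 0 < t by rewrite /t; lra.
  have [|c c0 cN] := N_growth t t0; first by rewrite /t; lra.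
  apply: ereal_inf_lbound; exists s => //; split=> //.
  apply: (hausdorff_measure_boxes_eq0 k s c t) => //; first exact: ltW.
    by rewrite /t; lra.
  move=> a; have [L LN LX] := N_box a jX.
  by exists L; rewrite ?LN// XE.
apply: le_ereal_inf_tmp => _ [s [s0 Hs] <-].
rewrite lee_fin ler_pdivrMr// -ln_powR ler_ln ?posrE ?powR_gt0//.
apply: spectral_radius_le => l lA; rewrite leNgt; apply/negP => kl.
have A_ge0 i j : 0 <= A i j by rewrite mxE.
have [v [v0 [j vj] lv]] := real_subeigenvector _ _ _ A_ge0 lA.
have [a0 [b0 [_ jE]]] := (kX j).1.
have ks1 : 1 <= k%:R `^ s.
  by rewrite -[leLHS](powRr0 (k%:R)) ler_powR// ler1n ltnW.
have l1 : 1 < Normc.normc l by exact: le_lt_trans kl.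
pose V := \sum_i v i.
have vV i : v i <= V by rewrite /V (bigD1 i)//= lerDl sumr_ge0.
have V0 : 0 < V by exact: lt_le_trans (vV j).
have V3 : 0 < V * (3 ^ d)%:R by rewrite mulr_gt0// ltr0n expn_gt0.
have kappa0 : 0 < v j / (V * (3 ^ d)%:R) by rewrite divr_gt0.
suff : hausdorff_measure s X != 0%E by rewrite Hs eqxx.
apply: (hausdorff_measure_neq0 k a0 b0 s _ _ X (Xs j) hk s0 l1 (ltW kl) kappa0
  cX jE).
move=> S SX; rewrite ler_pdivrMr// mulrC.
apply: (ball_cover_weight hk Xs) => //; first exact: ltW.
exact: lt_trans l1.
Qed.
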